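(* Let $d\ge 2$ and $n\ge 2$ be integers. If $\mathcal{K}=\{\mathbf{x}_i+\tau_i\mathbf{K} : \mathbf{x}_i\in\mathbb{R}^d,\ \tau_i>0,\ i=1,2,\ldots,n\}$ is an arbitrary NS-family of positive homothetic copies of a convex body $\mathbf{K}$ in $\mathbb{R}^d$, then $$\lambda(\mathcal{K})\le d.$$
   Context: A convex body in $\mathbb{R}^d$ is a compact convex subset of $\mathbb{R}^d$ with non-empty interior. A positive homothetic copy of $\mathbf{K}$ is a set $\mathbf{x}+\tau\mathbf{K}$ with $\mathbf{x}\in\mathbb{R}^d$ and $\tau>0$. The family $\mathcal{K}$ is called a non-separable family, in short an NS-family, if every hyperplane of $\mathbb{R}^d$ that intersects $\operatorname{conv}\left(\bigcup\mathcal{K}\right)$ intersects a member of $\mathcal{K}$ (equivalently, no hyperplane disjoint from $\bigcup\mathcal{K}$ strictly separates some members of $\mathcal{K}$ from all the other members). For an NS-family, $\lambda(\mathcal{K})>0$ denotes the smallest positive value $\lambda$ such that some translate of $\lambda\left(\sum_{i=1}^n\tau_i\right)\mathbf{K}$ covers $\bigcup\mathcal{K}$. *)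

(* Defs.v *)
From mathcomp Require Import all_boot all_order all_algebra.
From mathcomp Require Import all_classical all_reals all_analysis.

Set Implicit Arguments.
Unset Strict Implicit.
Unset Printing Implicit Defensive.

Import Order.TTheory GRing.Theory Num.Theory.
Import numFieldNormedType.Exports.

Local Open Scope classical_set_scope.
Local Open Scope ring_scope.

(* 'rV[R]_d carries the sup norm, which induces the Euclidean topology. *)
Definition convex_body (R : realType) (d : nat) (K : set 'rV[R]_d) : Prop :=
  [/\ compact K, convex_set K & K° !=set0].

Definition homothet (R : realType) (d : nat) (K : set 'rV[R]_d)
    (x : 'rV[R]_d) (t : R) : set 'rV[R]_d :=
  [set x + t *: y | y in K].

Definition conv_hull (R : realType) (d : nat) (A : set 'rV[R]_d) :
    set 'rV[R]_d :=
  smallest (@convex_set R 'rV[R]_d) A.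

(* A hyperplane only when u != 0. *)
Definition hyperplane (R : realType) (d : nat) (u : 'rV[R]_d) (c : R) :
    set 'rV[R]_d :=
  [set y | \sum_(j < d) u ord0 j * y ord0 j = c].

(* Families are indexed: repeated members are allowed. *)
Definition NS_family (R : realType) (d n : nat) (F : 'I_n -> set 'rV[R]_d) :
    Prop :=
  forall (u : 'rV[R]_d) (c : R), u != 0 ->
    hyperplane u c `&` conv_hull (\bigcup_i F i) !=set0 ->
    exists i, hyperplane u c `&` F i !=set0.

Definition cover_ratios (R : realType) (d n : nat) (K : set 'rV[R]_d)
    (x : 'I_n -> 'rV[R]_d) (tau : 'I_n -> R) : set R :=
  [set l | 0 < l /\ exists z : 'rV[R]_d,
    \bigcup_i homothet K (x i) (tau i) `<=`
    homothet K z (l * \sum_i tau i)].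

(* The infimum is a minimum, see lambda_smallest below. *)
Definition lambda (R : realType) (d n : nat) (K : set 'rV[R]_d)
    (x : 'I_n -> 'rV[R]_d) (tau : 'I_n -> R) : R :=
  inf (cover_ratios K x tau).

Section LambdaSmallest.
Variables (R : realType) (d n : nat) (K : set 'rV[R]_d).
Variables (x : 'I_n -> 'rV[R]_d) (tau : 'I_n -> R).
Hypotheses (d_gt0 : (0 < d)%N) (n_gt0 : (0 < n)%N).
Hypotheses (bodyK : convex_body K) (tau_gt0 : forall i, 0 < tau i).

Let U := \bigcup_i homothet K (x i) (tau i).
Let T := \sum_i tau i.
Let i0 := Ordinal n_gt0.

Let T_gt0 : 0 < T.
Proof.
rewrite /T (bigD1 i0) //= ltr_pwDl // sumr_ge0 // => i _; exact: ltW.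
Qed.

Let ball_in_K : exists c : 'rV[R]_d, exists2 e : R, 0 < e &
  forall v, `|v| < e -> K (c + v).
Proof.
have [_ _ [c /nbhs_ballP [e /= e0 ce]]] := bodyK.
exists c, e => // v ve; apply: ce.
by rewrite -ball_normE /ball_ /= opprD addNKr normrN.
Qed.

Let cover_ratios_neq0 : cover_ratios K x tau !=set0.
Proof.
have [c [e e0 ce]] := ball_in_K.
have [cK _ _] := bodyK.
have [M [_ /(_ (`|M| + 1))]] := compact_bounded cK.
rewrite (le_lt_trans (ler_norm M)) ?ltrDl // => /(_ isT) KM.
set N := `|M| + 1 in KM.
have N0 : 0 < N by rewrite /N ltr_wpDl.
pose B := \sum_i (`|x i| + tau i * N) + 1.
have B0 : 0 < B.
  rewrite /B ltr_wpDl ?sumr_ge0 // => i _.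
  by rewrite addr_ge0 // mulr_ge0 // ltW.
have l0 : 0 < B / e / T by rewrite !divr_gt0.
exists (B / e / T); split=> //; rewrite divfK ?gt_eqF //.
have s0 : B / e != 0 by rewrite gt_eqF // divr_gt0.
exists (- (B / e) *: c) => p [i _ [y Ky <-]].
exists (c + (B / e)^-1 *: (x i + tau i *: y)); last first.
  by rewrite scalerDr scalerA divff // scale1r scaleNr addKr.
apply: ce; rewrite normrZ gtr0_norm ?invr_gt0 ?divr_gt0 //.
rewrite invf_div mulrC mulrCA -ltr_pdivlMl // mulVf ?gt_eqF //.
rewrite ltr_pdivrMr // mul1r /B.
apply: (@le_lt_trans _ _ (`|x i| + tau i * N)).
  rewrite (le_trans (ler_normD _ _)) // lerD2l normrZ gtr0_norm //.
  by rewrite ler_pM2l //; apply: KM.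
rewrite (bigD1 i) //= -addrA ltrDl ltr_wpDl // sumr_ge0 // => j _.
by rewrite addr_ge0 // mulr_ge0 // ltW.
Qed.

Let U_not_singleton (z : 'rV[R]_d) : ~ (U `<=` [set z]).
Proof.
move=> Uz; have [c [e e0 ce]] := ball_in_K.
have Kc : K c by rewrite -[c]addr0; apply: ce; rewrite normr0.
pose v : 'rV[R]_d := const_mx 1.
have v0 : 0 < `|v|.
  rewrite normr_gt0; apply/eqP => /rowP /(_ (Ordinal d_gt0)).
  by rewrite !mxE => /eqP; rewrite oner_eq0.
pose w := (e / 2 / `|v|) *: v.
have wE : `|w| = e / 2.
  by rewrite normrZ gtr0_norm ?divr_gt0 // divfK // gt_eqF.
have Kw : K (c + w).
  by apply: ce; rewrite wE ltr_pdivrMr // ltr_pMr // ltr1n.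
have /Uz /= z1 : U (x i0 + tau i0 *: c) by exists i0 => //; exists c.
have /Uz /= : U (x i0 + tau i0 *: (c + w)) by exists i0 => //; exists (c + w).
rewrite -z1 => /addrI/eqP.
rewrite -subr_eq0 -scalerBr addrAC subrr add0r scaler_eq0.
rewrite gt_eqF //= -normr_eq0 wE mulf_eq0 gt_eqF //= invr_eq0.
by rewrite pnatr_eq0.
Qed.

Lemma lambda_smallest :
  cover_ratios K x tau (lambda K x tau) /\
  lbound (cover_ratios K x tau) (lambda K x tau).
Proof.
have lb0 : has_lbound (cover_ratios K x tau).
  by exists 0 => l [/ltW].
suff [m Sm mS] : exists2 m, cover_ratios K x tau m &
    lbound (cover_ratios K x tau) m.
  suff -> : lambda K x tau = m by [].
  apply/eqP; rewrite eq_le; apply/andP; split; first exact: ge_inf.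
  by apply: lb_le_inf => //; exists m.
have [cK _ _] := bodyK; have [c [e e0 ce]] := ball_in_K.
have Kc : K c by rewrite -[c]addr0; apply: ce; rewrite normr0.
have [M SM] := cover_ratios_neq0.
pose p0 := x i0 + tau i0 *: c.
have Up0 : U p0 by exists i0 => //; exists c.
pose f (q : R * 'rV[R]_d) := p0 - (q.1 * T) *: q.2.
pose D : set (R * 'rV[R]_d) := `[0, M]%classic `*` K.
have cD : compact D by apply: compact_setX => //; exact: segment_compact.
pose A := D `&` \bigcap_(p in U) [set q | homothet K (f q) (q.1 * T) p].
have key : forall l, cover_ratios K x tau l -> l <= M ->
    exists k, A (l, k).
  move=> l [l0 [z Uz]] lM; have [k Kk zk] := Uz _ Up0; exists k; split.
    by split=> //=; rewrite in_itv /= lM ltW.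
  move=> p Up /=; rewrite /f /= -zk addrK; exact: Uz.
have hausRV : hausdorff_space (R * 'rV[R]_d)%type.
  exact: norm_hausdorff.
have cA : compact A.
  have -> : A = \bigcap_(p in U) (D `&` [set q | homothet K (f q) (q.1 * T) p]).
    apply/seteqP; split=> [q [Dq Hq] p Up|q Hq]; first by split=> //; exact: Hq.
    by split=> [|p Up]; [case: (Hq _ Up0)|case: (Hq _ Up)].
  have cp p : compact (D `&` [set q | homothet K (f q) (q.1 * T) p]).
    pose g (r : (R * 'rV[R]_d) * 'rV[R]_d) := f r.1 + (r.1.1 * T) *: r.2.
    have -> : D `&` [set q | homothet K (f q) (q.1 * T) p] =
        fst @` ((D `*` K) `&` g @^-1` [set p]).
      apply/seteqP; split=> [q [Dq [k Kk kp]]|_ [[q k] [[/= Dq Kk] gp] <-]].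
        by exists (q, k).
      by split=> //; exists k.
    apply: continuous_compact.
      by apply: continuous_subspaceT => q; exact: cvg_fst.
    apply: compact_closedI; first exact: compact_setX.
    apply: preimage_closed; last first.
      exact/accessible_closed_set1/hausdorff_accessible/norm_hausdorff.
    move=> r _; rewrite /g /f.
    have cv1 : (fun r : (R * 'rV[R]_d) * 'rV[R]_d => r.1.1 * T) @ r --> r.1.1 * T.
      apply: cvgMl; apply: (@cvg_comp _ _ _ fst fst); exact: cvg_fst.
    apply: cvgD; last by apply: cvgZ => //; exact: cvg_snd.
    apply: cvgB; first exact: cvg_cst.
    apply: cvgZ => //.
    apply: (@cvg_comp _ _ _ fst snd); [exact: cvg_fst|exact: cvg_snd].
  apply: (@subclosed_compact _ _ D) => //.
    apply: closed_bigI => p _; exact: compact_closed.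
  by move=> q /(_ _ Up0) [].
have A0 : A !=set0 by have [k Ak] := key M SM (lexx _); exists (M, k).
have [[m k] mA mmin] := @compact_EVT_min _ _ fst A A0 cA
  (continuous_subspaceT (fun q => @cvg_fst _ _ _ _ _)).
move: mA; rewrite inE => -[[/= + Kk] Hm]; rewrite in_itv /= => /andP[m0 mM].
exists m; last first.
  move=> l Sl; case: (leP l M) => [lM|/ltW Ml]; last exact: le_trans mM Ml.
  by have [k' Ak'] := key _ Sl lM; apply: (mmin (l, k')); rewrite inE.
split; last by exists (f (m, k)) => p /Hm.
rewrite lt_neqAle m0 andbT; apply/eqP => m00.
apply: (@U_not_singleton p0) => p /Hm [y _] /=; rewrite /f /= -m00.
by rewrite !mul0r !scale0r subr0 addr0.
Qed.

End LambdaSmallest.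

(* Main.v *)
Require Import Defs.
From mathcomp Require Import all_boot all_order all_algebra.
From mathcomp Require Import all_classical all_reals all_analysis.
From mathcomp Require Import perm ring lra.
Import Order.TTheory GRing.Theory Num.Theory.
Import numFieldNormedType.Exports.
Local Open Scope ring_scope.

Set Implicit Arguments.
Unset Strict Implicit.
Unset Printing Implicit Defensive.

(** Why the theorem is true.  Minkowski's measure of asymmetry is at most [d]:
    there is a point [c] with [-(K - c)] contained in [d (K - c)]
    ([asymmetry_center]).  One may take for [c] the centroid of a simplex of
    maximal volume inscribed in [K]: by maximality every point of [K] has all
    its barycentric coordinates at most 1, which is what being contained in
    the [-d]-fold copy of the simplex about its centroid means.

    Put [X_i = x_i + tau_i c], [T = sum_i tau_i] and let
    [G = (sum_i tau_i X_i) / T] be the weighted barycentre.  The claim is that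
    [G + d T (K - c)] contains every member of the family
    ([NS_family_subset_homothet]).  A compact convex set is an intersection of
    half-spaces ([compact_convex_separation]), so it is enough to compare both
    sides in one direction [u] at a time.

    There the problem is one-dimensional.  Let [b] and [a] be the extents of
    [K - c] in the directions [u] and [-u], so that [a <= d b].  The members
    project to intervals [[xi_i - tau_i a, xi_i + tau_i b]], and
    non-separability says that their union has no gap ([NS_family_levels]).
    Hence the distance from a right endpoint [r_i] up to a right endpoint [r_m]
    is at most the total length [(a + b) sum tau_j] of the intervals ending beyond [r_i]
    ([cover_length]).  Averaging over [i] with weights [tau_i], each unordered
    pair [{i, j}] contributes [tau_i tau_j] at most once, so with
    [Q = sum_i tau_i ^ 2],
      [T r_m <= sum_i tau_i xi_i + b Q + (a + b) / 2 * (T ^ 2 - Q)],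
    and the right-hand side is at most [sum_i tau_i xi_i + d b T ^ 2] because
    [a <= d b] ([interval_barycenter]).  Dividing by [T], the point [r_m] does
    not exceed the support value of [G + d T (K - c)]. *)

(** * Gapless unions of intervals *)

(** Sweeping from [s] to [M]: among the intervals ending beyond [s], the one
    with the least left endpoint must start at or before [s], since otherwise
    the points just above [s] would be uncovered.  It accounts for the stretch
    from [s] to its own right endpoint, and the sweep resumes from there with
    one interval fewer. *)
Lemma cover_length (R : realFieldType) (I : finType) (l r : I -> R) (s M : R) :
  (forall k, l k <= r k) ->
  (forall t, s < t <= M -> exists k, l k <= t <= r k) ->
  M - s <= \sum_(k | s < r k) (r k - l k).
Proof.
move=> lr; have [m] := ubnP #|[pred k | s < r k]|.
elim: m s => // m IHm s ltm cov.
have [Ms|sM] := leP M s.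
  by rewrite (@le_trans _ _ 0) ?subr_le0// sumr_ge0// => k _; rewrite subr_ge0.
have [k0 /andP[_ Mr0]] : exists k, l k <= M <= r k.
  by apply: cov; rewrite sM lexx.
case: (@Order.TotalTheory.arg_minP _ _ _ k0 (fun k => s < r k) l);
  first exact: lt_le_trans Mr0.
move=> j sj jmin.
have ljs : l j <= s.
  rewrite leNgt; apply/negP => slj.
  (* [t] lies in the gap between [s] and [l j], yet not above [M]. *)
  pose t := Num.min M ((s + l j) / 2).
  have st : s < t by rewrite /t lt_min sM /=; lra.
  have tM : t <= M by rewrite /t ge_min lexx.
  have tl : t < l j by rewrite /t gt_min; apply/orP; right; lra.
  have [|k /andP[lkt tk]] := cov t; first by rewrite st tM.
  by have := jmin k (lt_le_trans st tk); rewrite leNgt (le_lt_trans lkt tl).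
rewrite (bigD1 j)//=.
have IH : M - r j <= \sum_(k | r j < r k) (r k - l k).
  apply: IHm => [|t /andP[jt tM]]; last by apply: cov; rewrite tM (lt_trans sj jt).
  rewrite -ltnS (leq_trans _ ltm)// ltnS; apply/proper_card/properP; split.
    by apply/fintype.subsetP => k; rewrite !inE; exact: lt_trans.
  by exists j; rewrite !inE ?ltxx.
have sub : \sum_(k | r j < r k) (r k - l k) <=
    \sum_(k | (s < r k) && (k != j)) (r k - l k).
  rewrite big_mkcond [leRHS]big_mkcond/= ler_sum// => k _.
  case: ifP => [jk|_]; last by case: ifP => // _; rewrite subr_ge0.
  by rewrite (lt_trans sj jk)/=; case: eqP jk => [->|//]; rewrite ltxx.
lra.
Qed.

(** Expanding the square: for [i != j] the product [tau i * tau j] occurs twice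
    on the right, and at most one of [r i < r j] and [r j < r i] holds. *)
Lemma sum_ordered_pairs_le (R : realFieldType) (I : finType) (tau r : I -> R) :
  (forall i, 0 <= tau i) ->
  (\sum_i \sum_(j | r i < r j) tau i * tau j) *+ 2 + \sum_i tau i ^+ 2
    <= (\sum_i tau i) ^+ 2.
Proof.
move=> tau0.
rewrite expr2 big_distrl/= mulr2n.
rewrite [X in _ + X + _ <= _](_ : _ = \sum_i \sum_(j | r j < r i) tau i * tau j).
  rewrite -!big_split/= ler_sum// => i _.
  rewrite mulr_sumr [leRHS](bigID (fun j => r i < r j))/= -addrA lerD2l.
  rewrite [leRHS](bigD1 i) ?ltxx//= -expr2 addrC lerD2l.
  rewrite big_mkcond [leRHS]big_mkcond/= ler_sum// => j _.
  by case: (ltgtP (r i) (r j)) => [||E]; case: eqVneq => [<-|]; rewrite ?ltxx ?mulr_ge0.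
rewrite (exchange_big_dep predT)//=; apply: eq_bigr => i _.
by apply: eq_bigr => j _; rewrite mulrC.
Qed.

(** A one-dimensional form of the covering theorem: the union of intervals of
    lengths proportional to [tau], if it has no gaps, cannot reach far beyond
    the weighted mean of the reference points [xi].  The constant [c] bounds
    how much farther an interval may extend below its reference point than
    above it. *)
Lemma interval_barycenter (R : realFieldType) (I : finType) (tau xi : I -> R)
    (a b c : R) (m : I) :
  (forall i, 0 <= tau i) -> 0 <= a + b -> a <= c * b -> 1 <= c ->
  (forall i t, xi i + tau i * b <= t <= xi m + tau m * b ->
     exists k, xi k - tau k * a <= t <= xi k + tau k * b) ->
  (\sum_i tau i) * (xi m + tau m * b) <=
    \sum_i tau i * xi i + c * b * (\sum_i tau i) ^+ 2.
Proof.
move=> tau0 ab0 acb c1 cov.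
pose r i := xi i + tau i * b.
pose T := \sum_i tau i; pose Q := \sum_i tau i ^+ 2.
pose P := \sum_i \sum_(j | r i < r j) tau i * tau j.
have PQ : P *+ 2 + Q <= T ^+ 2 by exact: sum_ordered_pairs_le.
have Q0 : 0 <= Q by apply: sumr_ge0 => i _; rewrite sqr_ge0.
have P0 : 0 <= P by do 2! [apply: sumr_ge0 => ? _]; exact: mulr_ge0.
(* No gap lies between [r i] and [r m], so the intervals ending beyond [r i]
   fill the way from one to the other. *)
have gap i : r m - r i <= (a + b) * \sum_(j | r i < r j) tau j.
  have := @cover_length _ _ (fun k => xi k - tau k * a) r (r i) (r m).
  rewrite mulr_sumr; under eq_bigr => k _.
    rewrite (_ : r k - _ = (a + b) * tau k); last by rewrite /r; ring.
  over.
  apply=> [k|t /andP[/ltW it tm]]; last by apply: (cov i); rewrite it.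
  by rewrite /r -subr_ge0 (_ : _ - _ = tau k * (a + b)) ?mulr_ge0//; ring.
have step : T * r m - \sum_i tau i * r i <= (a + b) * P.
  rewrite /T mulr_suml -sumrB /P mulr_sumr ler_sum// => i _.
  rewrite -mulrBr -mulr_sumr mulrCA; exact: ler_wpM2l.
have rE : \sum_i tau i * r i = \sum_i tau i * xi i + b * Q.
  rewrite mulr_sumr -big_split/=; apply: eq_bigr => i _; rewrite /r; ring.
rewrite -/(r m) -/T.
have b0 : 0 <= b.
  rewrite leNgt; apply/negP => b0.
  by have : 0 <= (c - 1) * - b; [apply: mulr_ge0; lra|lra].
have : (a + b) * P * 2 <= (a + b) * (T ^+ 2 - Q) by rewrite -mulrA ler_wpM2l//; lra.
have : 0 <= (c * b - a) * (T ^+ 2 - Q) by apply: mulr_ge0; lra.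
have : 0 <= (c - 1) * b * (T ^+ 2 - Q) by rewrite !mulr_ge0//; lra.
have : 0 <= (c - 1) * b * Q by rewrite !mulr_ge0//; lra.
rewrite rE in step; lra.
Qed.

(** * Convex sets and separation *)

Lemma convex_set_segment (R : realType) (d : nat) (K : set 'rV[R]_d)
    (x y : 'rV[R]_d) (t : R) :
  convex_set K -> K x -> K y -> 0 <= t <= 1 -> K (t *: x + (1 - t) *: y).
Proof.
move=> cK Kx Ky /andP[t0 t1].
by have := cK x y (Itv01 t0 t1); rewrite !inE; apply.
Qed.

Lemma convex_set_sum (R : realType) (d m : nat) (K : set 'rV[R]_d)
    (w : 'I_m -> R) (v : 'I_m -> 'rV[R]_d) :
  convex_set K -> (forall i, 0 <= w i) -> (forall i, K (v i)) ->
  \sum_i w i = 1 -> K (\sum_i w i *: v i).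
Proof.
move=> cK; elim: m w v => [|m IHm] w v w0 Kv.
  by rewrite big_ord0 => /esym/eqP; rewrite oner_eq0.
rewrite !big_ord_recl; set s := \sum_(i < m) _ => ws.
have s0 : 0 <= s by apply: sumr_ge0.
have sE : s = 1 - w ord0 by rewrite -ws addrC addKr.
have [s00|s_neq0] := eqVneq s 0.
  rewrite big1 ?addr0 => [|i _].
    by move: sE; rewrite s00 => /esym/subr0_eq <-; rewrite scale1r.
  have /psumr_eq0P -> // := s00; first by rewrite scale0r.
pose w' i := w (lift ord0 i) / s.
have -> : \sum_(i < m) w (lift ord0 i) *: v (lift ord0 i) =
    s *: \sum_(i < m) w' i *: v (lift ord0 i).
  by rewrite scaler_sumr; apply: eq_bigr => i _; rewrite scalerA mulrC divfK.
rewrite sE; apply: convex_set_segment => //.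
  apply: IHm => [i|i|]; [by rewrite divr_ge0|exact: Kv|].
  by rewrite /w' -mulr_suml divff.
by rewrite w0 -subr_ge0 -sE.
Qed.

Section dot.
Variables (R : realType) (d : nat).
Implicit Types u v : 'rV[R]_d.

Definition dot u v := \sum_(j < d) u ord0 j * v ord0 j.

Lemma dotC u v : dot u v = dot v u.
Proof. by apply: eq_bigr => j _; rewrite mulrC. Qed.

Lemma dotDr u v w : dot u (v + w) = dot u v + dot u w.
Proof. by rewrite -big_split; apply: eq_bigr => j _; rewrite mxE mulrDr. Qed.

Lemma dotZr u a v : dot u (a *: v) = a * dot u v.
Proof. by rewrite mulr_sumr; apply: eq_bigr => j _; rewrite mxE mulrCA. Qed.

Lemma dotBr u v w : dot u (v - w) = dot u v - dot u w.
Proof. by rewrite -scaleN1r dotDr dotZr mulN1r. Qed.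

Lemma dot_sumr (I : finType) u (v : I -> 'rV[R]_d) :
  dot u (\sum_i v i) = \sum_i dot u (v i).
Proof.
apply: (big_morph (dot u)); first exact: dotDr.
by rewrite -(scale0r 0) dotZr mul0r.
Qed.

Lemma dot_subZ_sq u v t : dot (u - t *: v) (u - t *: v) =
  dot u u - 2 * t * dot u v + t ^+ 2 * dot v v.
Proof.
rewrite dotBr dotZr !(dotC (u - t *: v)) !dotBr !dotZr (dotC v u).
ring.
Qed.

Lemma dotvv_ge0 u : 0 <= dot u u.
Proof. by apply: sumr_ge0 => j _; rewrite -expr2 sqr_ge0. Qed.

Lemma dotvv_gt0 u : u != 0 -> 0 < dot u u.
Proof.
move=> u0; rewrite lt_neqAle dotvv_ge0 andbT eq_sym; apply: contra u0.
rewrite psumr_eq0 => [/allP uu|j _]; last by rewrite -expr2 sqr_ge0.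
apply/eqP/rowP => j; rewrite mxE; apply/eqP.
by have := uu j (mem_index_enum _); rewrite mulf_eq0 orbb.
Qed.

Lemma dot_continuous u : continuous (dot u : 'rV[R]_d -> R).
Proof.
apply: continuous_big => [|j _]; first exact: add_continuous.
move=> v; apply: continuousM; first exact: cst_continuous.
exact: coord_continuous.
Qed.

End dot.

Lemma dot_attains_max (R : realType) (d : nat) (K : set 'rV[R]_d)
    (u : 'rV[R]_d) :
  compact K -> (K !=set0)%classic ->
  exists2 k, K k & forall y, K y -> dot u y <= dot u k.
Proof.
move=> cK K0.
have [k] := EVT_max_rV K0 cK (continuous_subspaceT (@dot_continuous R d u)).
by rewrite inE => Kk kmax; exists k => // y Ky; apply: kmax; rewrite inE.
Qed.

(** The normal [u] points from the nearest point [k0] of [K], in Euclidean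
    distance, to [p]: if some [y] in [K] had [dot u (y - k0) > 0], a small step
    from [k0] towards [y] would come closer to [p]. *)
Lemma compact_convex_separation (R : realType) (d : nat) (K : set 'rV[R]_d)
    (p : 'rV[R]_d) :
  compact K -> convex_set K -> (K !=set0)%classic -> ~ K p ->
  exists2 u, u != 0 & forall y, K y -> dot u y < dot u p.
Proof.
move=> cK cvK K0 Kp.
pose f (k : 'rV[R]_d) := dot (p - k) (p - k).
have cf : continuous f.
  apply: continuous_big => [|j _]; first exact: add_continuous.
  have c1 : continuous (fun k : 'rV[R]_d => (p - k) ord0 j).
    under eq_fun do rewrite !mxE.
    by move=> k; apply: continuousB; [exact: cst_continuous|exact: coord_continuous].
  by move=> k; apply: continuousM; exact: c1.
have [k0] := EVT_min_rV K0 cK (continuous_subspaceT cf).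
rewrite inE => Kk0 kmin; pose u := p - k0.
have u0 : u != 0 by rewrite subr_eq0; apply: contra_notN Kp => /eqP ->.
exists u => // y Ky; pose v := y - k0.
have uu := dotvv_gt0 u0; have vv := dotvv_ge0 v.
suff uv : dot u v <= 0.
  have -> : y = p - u + v by rewrite /u /v subKr addrC subrK.
  by rewrite dotDr dotBr; lra.
rewrite leNgt; apply/negP => uv.
(* A step [t <= 1] short enough for the linear term of the squared distance to
   outweigh the quadratic one. *)
pose t := dot u v / (dot u v + dot v v).
have s0 : 0 < dot u v + dot v v by rewrite ltr_pwDl.
have t0 : 0 < t by rewrite divr_gt0.
have t1 : t <= 1 by rewrite ler_pdivrMr// mul1r lerDl.
have : f k0 <= f (t *: y + (1 - t) *: k0).
  by apply: kmin; rewrite inE; apply: convex_set_segment; rewrite ?(ltW t0).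
rewrite /f -/u (_ : p - _ = u - t *: v); last first.
  by apply/rowP => j; rewrite !mxE; ring.
rewrite dot_subZ_sq.
have tE : t * (dot u v + dot v v) = dot u v by rewrite divfK ?gt_eqF.
have : 0 < t * dot u v by exact: mulr_gt0.
have : t * (t * (dot u v + dot v v)) = t * dot u v by rewrite tE.
have : 0 < t * (t * dot u v) by do 2! apply: mulr_gt0 => //.
lra.
Qed.

(** * Simplices of maximal volume and asymmetry *)

Section max_simplex.
Variables (R : realType) (d : nat).

(** The determinant is, up to sign, [d`!] times the volume of the simplex with
    vertices [V]; the equation [w *m affine_mx V = row_mx 1 y] says that [w] is
    the vector of barycentric coordinates of [y] with respect to [V]. *)
Definition affine_mx (V : 'I_(1 + d) -> 'rV[R]_d) : 'M[R]_(1 + d) :=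
  \matrix_i row_mx 1%:M (V i).

(** The product topology makes the tuples of points of a compact set a compact
    set, by Tychonoff's theorem. *)
Definition vertex_tuples := prod_topology (fun _ : 'I_(1 + d) => 'rV[R]_d).

Lemma affine_mx_continuous i j :
  continuous (fun V : vertex_tuples => affine_mx V i j).
Proof.
have [k ->|k ->] := split_ordP j.
  rewrite (_ : (fun _ => _) = fun=> (1%:M : 'M[R]_1) ord0 k).
    by move=> V; exact: cst_continuous.
  by apply/funext => V; rewrite [LHS]mxE row_mxEl.
rewrite (_ : (fun _ => _) = fun V : vertex_tuples => V i ord0 k).
  move=> V; apply: (@cvg_comp _ _ _ (fun V : vertex_tuples => V i)
    (fun v : 'rV[R]_d => v ord0 k)); last exact: coord_continuous.
  exact: (@proj_continuous _ (fun _ : 'I_(1 + d) => 'rV[R]_d) i).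
by apply/funext => V; rewrite [LHS]mxE row_mxEr.
Qed.

Lemma det_affine_mx_continuous :
  continuous (fun V : vertex_tuples => `|\det (affine_mx V)|).
Proof.
suff cdet : continuous (fun V : vertex_tuples => \det (affine_mx V)).
  move=> V; apply: (@continuous_comp vertex_tuples R R _ Num.norm); first exact: cdet.
  exact: (@norm_continuous R R).
rewrite /determinant; apply: continuous_big => [|s _]; first exact: add_continuous.
move=> V; apply: (@continuousM R vertex_tuples (fun=> (-1) ^+ s)
    (fun V => \prod_i affine_mx V i (s i))); first exact: cst_continuous.
apply: continuous_big => [|i _]; first exact: mul_continuous.
exact: affine_mx_continuous.
Qed.

(** A small coordinate simplex with one vertex at an interior point. *)
Lemma nondegenerate_simplex (K : set 'rV[R]_d) : (K° !=set0)%classic ->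
  exists2 V, forall i, K (V i) & \det (affine_mx V) != 0.
Proof.
move=> [c /nbhs_ballP[e /= e0 ce]].
pose h : R := e / 2.
have h0 : 0 < h by rewrite divr_gt0.
pose V (i : 'I_(1 + d)) :=
  c + (if fintype.split i is inr j then h *: delta_mx ord0 j else 0).
exists V.
  move=> i; apply: ce; split=> [|a j]; [exact: e0|].
  rewrite ord1 -ball_normE /ball_ /= /V !mxE.
  rewrite opprD addNKr normrN.
  have he : `|h| < e by rewrite gtr0_norm// ltr_pdivrMr// ltr_pMr// ltr1n.
  case: fintype.split => [k|k]; rewrite !mxE ?normr0//=.
  by case: eqP => _; rewrite ?mulr1// mulr0 normr0.
have splitl : fintype.split (lshift d ord0) = inl ord0 :> 'I_1 + 'I_d :=
  unsplitK (inl ord0).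
have splitr j : fintype.split (rshift 1 j) = inr j :> 'I_1 + 'I_d :=
  unsplitK (inr j).
(* Subtracting the first vertex from the others makes the matrix triangular. *)
have -> : affine_mx V =
    block_mx 1%:M 0 (const_mx 1) h%:M *m block_mx 1%:M c 0 1%:M.
  rewrite mulmx_block !mul1mx !mul0mx !mulmx1 !mulmx0 !addr0.
  apply/matrixP => i j; rewrite mxE.
  have [i' ->|i' ->] := split_ordP i; have [j' ->|j' ->] := split_ordP j;
    rewrite ?block_mxEul ?block_mxEur ?block_mxEdl ?block_mxEdr
      ?row_mxEl ?row_mxEr ?ord1 ?mxE//=.
  - by rewrite splitl mxE addr0.
  - by rewrite splitr big_ord1 !mxE mul1r eqxx [i' == j']eq_sym mulr_natr.
rewrite det_mulmx det_lblock det_ublock !det1 !mul1r mulr1 det_scalar.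
by rewrite expf_neq0// gt_eqF.
Qed.

Lemma max_simplex (K : set 'rV[R]_d) : compact K -> (K° !=set0)%classic ->
  exists V, [/\ forall i, K (V i), \det (affine_mx V) != 0 &
    forall W, (forall i, K (W i)) ->
      `|\det (affine_mx W)| <= `|\det (affine_mx V)|].
Proof.
move=> cK /nondegenerate_simplex[V0 KV0 V00].
pose A : set vertex_tuples := [set V | forall i, K (V i)]%classic.
have cA : compact A by apply: (@tychonoff _ (fun=> 'rV[R]_d) (fun=> K)).
have A0 : (A !=set0)%classic by exists V0.
have [V] := compact_EVT_max A0 cA (continuous_subspaceT det_affine_mx_continuous).
rewrite inE => KV Vmax; exists V; split=> // [|W KW]; last by apply: Vmax; rewrite inE.
by rewrite -normr_gt0 (lt_le_trans _ (Vmax V0 _)) ?inE// normr_gt0.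
Qed.

(** Cramer's rule: moving one vertex to the point of barycentric coordinates [w]
    multiplies the signed volume by the corresponding coordinate. *)
Lemma det_replace_row (V W : 'I_(1 + d) -> 'rV[R]_d) (w : 'rV[R]_(1 + d)) i :
  (forall k, k != i -> W k = V k) ->
  row_mx 1%:M (W i) = w *m affine_mx V ->
  \det (affine_mx W) = w ord0 i * \det (affine_mx V).
Proof.
move=> WV Wi; rewrite (expand_det_row _ i).
have -> : w ord0 i * \det (affine_mx V) =
    (row_mx 1%:M (W i) *m \adj (affine_mx V)) ord0 i.
  by rewrite Wi -mulmxA mul_mx_adj mul_mx_scalar mxE mulrC.
rewrite mxE; apply: eq_bigr => j _; rewrite mxE; congr (_ * _).
rewrite mxE; congr (_ * \det _); apply/matrixP => a b; rewrite !mxE.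
by rewrite WV// eq_sym neq_lift.
Qed.

(** Minkowski's asymmetry bound.  The centroid [c] of an inscribed simplex of
    maximal volume works: if [y] has barycentric coordinates [w], all at most 1
    by maximality, then [c + (c - y) / d] has coordinates [(1 - w i) / d], which
    are nonnegative and sum to 1. *)
Lemma asymmetry_center (K : set 'rV[R]_d) : (0 < d)%N -> convex_body K ->
  exists c, forall y, K y -> K (c + d%:R^-1 *: (c - y)).
Proof.
move=> d0 [cK cvK K0]; have [V [KV V0 Vmax]] := max_simplex cK K0.
have dR : d%:R != 0 :> R by rewrite pnatr_eq0 -lt0n.
have d1R : (1 + d)%:R != 0 :> R by rewrite pnatr_eq0.
exists ((1 + d)%:R^-1 *: \sum_i V i) => y Ky.
have [w wE] : exists w : 'rV[R]_(1 + d), w *m affine_mx V = row_mx 1%:M y.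
  exists (row_mx 1%:M y *m invmx (affine_mx V)).
  by rewrite mulmxKV// unitmxE unitfE.
have w1 i : w ord0 i <= 1.
  pose W k := if k == i then y else V k.
  have : `|\det (affine_mx W)| <= `|\det (affine_mx V)|.
    by apply: Vmax => k; rewrite /W; case: eqP.
  rewrite (@det_replace_row V W w i) => [|k /negbTE|]; rewrite /W ?eqxx//.
    rewrite normrM ger_pMl ?normr_gt0//; exact: le_trans (ler_norm _).
  by move=> ->.
have sumw : \sum_i w ord0 i = 1.
  have /matrixP /(_ ord0 (lshift d ord0)) := wE.
  rewrite row_mxEl !mxE eqxx mulr1n => <-; apply: eq_bigr => i _.
  by rewrite mxE row_mxEl mxE eqxx mulr1.
have sumwV : \sum_i w ord0 i *: V i = y.
  apply/rowP => j; have /matrixP /(_ ord0 (rshift 1 j)) := wE.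
  rewrite row_mxEr => <-; rewrite summxE mxE; apply: eq_bigr => i _.
  by rewrite mxE [in RHS]mxE row_mxEr.
have -> : (1 + d)%:R^-1 *: (\sum_i V i)
      + d%:R^-1 *: ((1 + d)%:R^-1 *: (\sum_i V i) - y) =
    \sum_i ((1 - w ord0 i) / d%:R) *: V i.
  rewrite -sumwV scalerBr addrA -[X in X + _]scale1r !scalerA -scalerDl.
  rewrite !scaler_sumr -sumrB; apply: eq_bigr => i _.
  rewrite !scalerA -scalerBl; congr (_ *: _).
  rewrite natrD in d1R *; field.
  by rewrite dR d1R.
apply: convex_set_sum => // [i|]; first by rewrite divr_ge0// subr_ge0.
rewrite -mulr_suml sumrB sumw sumr_const card_ord natrD addrAC subrr add0r.
by rewrite divff.
Qed.

End max_simplex.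

(** * Non-separable families *)

(** In every direction the projections of the members leave no gap: a level
    between those of two points of the family is attained on the segment joining
    them, so the hyperplane at that level meets the convex hull. *)
Lemma NS_family_levels (R : realType) (d n : nat) (F : 'I_n -> set 'rV[R]_d)
    (u p q : 'rV[R]_d) (t : R) (i j : 'I_n) :
  NS_family F -> u != 0 -> F i p -> F j q -> dot u p <= t <= dot u q ->
  exists k y, F k y /\ dot u y = t.
Proof.
move=> NSF u0 Fp Fq /andP[pt tq].
suff [y [yt hy]] : (hyperplane u t `&` conv_hull (\bigcup_i F i) !=set0)%classic.
  have [|k [z [zt Fz]]] := NSF u t u0; first by exists y.
  by exists k, z.
have [pq|pq] := eqVneq (dot u p) (dot u q).
  exists p; split; first by apply: (@le_anti _ _ (dot u p)); rewrite pt/= pq tq.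
  by move=> C [_ /(_ p)]; apply; exists i.
have pq0 : 0 < dot u q - dot u p.
  by rewrite subr_gt0 lt_neqAle pq (le_trans pt tq).
pose s := (dot u q - t) / (dot u q - dot u p).
exists (s *: p + (1 - s) *: q); split.
  rewrite /hyperplane /= -/(dot u _) dotDr !dotZr /s; field.
  by rewrite gt_eqF.
move=> C [cC UC]; apply: convex_set_segment => //.
- by apply: UC; exists i.
- by apply: UC; exists j.
- apply/andP; split; first by rewrite divr_ge0 ?subr_ge0 // -subr_ge0 ltW.
  by rewrite ler_pdivrMr// mul1r lerB.
Qed.

(** The covering copy, in which [c] is mapped to the barycentre of the points
    [x i + tau i *: c] with weights [tau].  The number [r] may be any bound on
    the asymmetry of [K] about [c]. *)
Lemma NS_family_subset_homothet (R : realType) (d n : nat) (K : set 'rV[R]_d)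
    (x : 'I_n -> 'rV[R]_d) (tau : 'I_n -> R) (c : 'rV[R]_d) (r : R) :
  compact K -> convex_set K -> (K !=set0)%classic -> 1 <= r ->
  (forall y, K y -> K (c + r^-1 *: (c - y))) ->
  (forall i, 0 < tau i) ->
  NS_family (fun i => homothet K (x i) (tau i)) ->
  let T := \sum_i tau i in
  (\bigcup_i homothet K (x i) (tau i) `<=`
    homothet K (T^-1 *: (\sum_i tau i *: (x i + tau i *: c)) - (r * T) *: c)
      (r * T))%classic.
Proof.
move=> cK cvK K0 r1 Kc tau0 NSF T _ [m _ [y0 Ky0 <-]].
have r0 : 0 < r by exact: lt_le_trans r1.
have T0 : 0 < T.
  by rewrite /T (bigD1 m)//= ltr_pwDl// sumr_ge0// => i _; exact: ltW.
set p := x m + tau m *: y0.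
pose X i := x i + tau i *: c.
rewrite -/(X _); pose G := T^-1 *: \sum_i tau i *: X i.
rewrite -/G; pose q := c + (r * T)^-1 *: (p - G).
suff Kq : K q.
  exists q => //; rewrite /q scalerDr scalerA divff ?gt_eqF ?mulr_gt0//.
  by rewrite scale1r addrA subrK addrC subrK.
apply: contrapT => /(compact_convex_separation cK cvK K0)[u u0 uq].
(* [k0] and [k1] are where the two supporting hyperplanes of [K] orthogonal to
   [u] touch it. *)
have [k0 Kk0 k0max] := dot_attains_max u cK K0.
have [k1 Kk1 k1min] := dot_attains_max (- u) cK K0.
have {}k1min y : K y -> dot u k1 <= dot u y.
  by move=> /k1min; rewrite !(dotC (- u)) -scaleN1r !dotZr !mulN1r lerN2 !(dotC u).
pose b := dot u k0 - dot u c; pose a := dot u c - dot u k1.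
have arb : a <= r * b.
  have := k0max _ (Kc _ Kk1); rewrite dotDr dotZr dotBr -/a.
  by rewrite mulrC -lerBrDl -/b ler_pdivrMr// mulrC.
have ab0 : 0 <= a + b.
  by have := k0max _ Kk1; rewrite /a /b; lra.
have top i : dot u (x i + tau i *: k0) = dot u (X i) + tau i * b.
  rewrite /X /b !dotDr !dotZr; ring.
have cov i t : dot u (X i) + tau i * b <= t <= dot u (X m) + tau m * b ->
    exists k, dot u (X k) - tau k * a <= t <= dot u (X k) + tau k * b.
  rewrite -!top => it.
  have [//|//|k [_ [[y Ky <-] <-]]] := NS_family_levels (i := i) (j := m) NSF u0 _ _ it.
  - by exists k0.
  - by exists k0.
  exists k; rewrite /X /a /b !dotDr !dotZr.
  have := ler_wpM2l (ltW (tau0 k)) (k0max _ Ky).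
  have := ler_wpM2l (ltW (tau0 k)) (k1min _ Ky).
  lra.
have := @interval_barycenter _ _ tau (fun i => dot u (X i)) a b r m
  (fun i => ltW (tau0 i)) ab0 arb r1 cov.
have -> : \sum_i tau i * dot u (X i) = T * dot u G.
  rewrite /G dotZr mulrA divff ?gt_eqF// mul1r dot_sumr.
  by apply: eq_bigr => i _; rewrite dotZr.
rewrite -top -/T -[r * b * _]mulrA expr2 !mulrA -[_ * T * T]mulrC -mulrDr ler_pM2l//.
move=> topm; have := uq _ Kk0.
have pm : dot u p <= dot u (x m + tau m *: k0).
  by rewrite /p !dotDr !dotZr lerD2l ler_pM2l//; exact: k0max.
rewrite /q dotDr dotZr dotBr -ltrBlDl -/b mulrC ltr_pdivlMr ?mulr_gt0//.
lra.
Qed.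

(** * The covering theorem *)

Theorem theorem3 (R : realType) (d n : nat) (hd : (2 <= d)%N) (hn : (2 <= n)%N)
    (K : set 'rV[R]_d) (hK : convex_body K)
    (x : 'I_n -> 'rV[R]_d) (tau : 'I_n -> R) (htau : forall i, 0 < tau i)
    (hNS : NS_family (fun i => homothet K (x i) (tau i))) :
  lambda K x tau <= d%:R.
Proof.
have d0 : (0 < d)%N by exact: ltnW.
have [_ lambda_min] := lambda_smallest x d0 (ltnW hn) hK htau.
have [c Kc] := asymmetry_center d0 hK; have [cK cvK [k /interior_subset Kk]] := hK.
apply: lambda_min; split; first by rewrite ltr0n.
eexists; apply: (NS_family_subset_homothet (c := c)) => //; first by exists k.
by rewrite ler1n.
Qed.
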